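(* Let $b$ be a block idempotent of $\mathcal{O}G$ with defect group $D$, let $A=l\mathcal{O}Gl$ be a source algebra of $b$, and let $\mathcal{F}$ be the saturated fusion system of $A$ on $D$. Suppose that there is a normal subgroup $\tilde{D}$ of $D$ containing $\mathrm{hyp}(\mathcal{F})$ such that the hyperfocal subalgebra $\tilde{A}$ of $A$ with respect to $\tilde{D}$ has a $D\times^{\bar{D}}D$-stable unital basis, where $\bar{D}=D/\tilde{D}$. Then $A$ has a $D\times D$-stable unital basis.
   Context: $\mathcal{O}$ is a complete local noetherian commutative ring with identity whose residue field $k$ is algebraically closed of prime characteristic $p$. All $\mathcal{O}$-modules and $\mathcal{O}$-algebras are finitely generated and free over $\mathcal{O}$; algebras are unital, and $B^\times$ denotes the unit group of $B$. A basis of an $\mathcal{O}$-algebra is an $\mathcal{O}$-basis of the underlying module; it is unital if each of its elements is invertible. A basis is stable under a group acting on the algebra if it is permuted by the group. $G$ is a finite group with $p$ dividing $|G|$. Source algebra: $b$ is a primitive central idempotent of $\mathcal{O}G$ with defect group $D$ (a $p$-subgroup of $G$). For a $p$-subgroup $R$ of $G$, $\mathrm{Br}_R^{\mathcal{O}G}:(\mathcal{O}G)^R\to kC_G(R)$ is the Brauer homomorphism. Let $l\in(\mathcal{O}Gb)^D$ be a primitive idempotent with $\mathrm{Br}_D^{\mathcal{O}G}(l)\neq 0$; then $A=l\mathcal{O}Gl$, with the structural map $D\to A^\times$, $u\mapsto ul$, is a source algebra of $b$. The group $D\times D$ acts on $A$ by $(u,v)a=uav^{-1}$. Fusion system: for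 each $R\le D$ there is a unique block $e_R$ of $kC_G(R)$ with $\mathrm{Br}_R^{\mathcal{O}G}(l)e_R\ne0$. $\mathcal{F}$ is the saturated fusion system on $D$ whose objects are the subgroups of $D$ and whose morphisms $R_1\to R_2$ are the conjugation maps $c_g: u\mapsto gug^{-1}$, with $g\in G$, ${}^gR_1\le R_2$ and ${}^ge_{R_1}=e_{{}^gR_1}$ (equivalently ${}^g(R_1,e_{R_1})\le (R_2,e_{R_2})$ as Brauer pairs). The hyperfocal subgroup is $\mathrm{hyp}(\mathcal{F})=\langle u\varphi(u^{-1})\mid R\le D,\ u\in R,\ \varphi\in O^p(\mathrm{Aut}_{\mathcal{F}}(R))\rangle$, where $O^p(X)$ is the smallest normal subgroup of $X$ whose quotient is a $p$-group. Hyperfocal subalgebra: let $\tilde D\trianglelefteq D$ contain $\mathrm{hyp}(\mathcal{F})$. By a theorem of Puig there is a unique, up to $(A^D)^\times$-conjugacy, $D$-stable unital subalgebra $\tilde A$ of $A$ such that $\tilde A\cap Dl=\tilde Dl$ and $A=\tilde A\otimes_{\tilde D}D$, i.e. $A=\bigoplus_{u}\tilde A u$ with $u$ running over representatives of $D/\tilde D$. It is called the hyperfocal subalgebra with respect to $\tilde D$. Put $\bar D=D/\tilde D$ and $D\times^{\bar D}D=\{(u,v)\in D\times D\mid u\tilde D=v\tilde D\}$; this group acts on $\tilde A$ by $(u,v)a=(uv^{-1})\cdot{}^va$, which equals $uav^{-1}$ computed in $A$. *)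

(* Defs.v *)
From HB Require Import structures.
From mathcomp Require Import all_boot all_order all_algebra.
From mathcomp Require Import all_fingroup all_solvable.
From mathcomp Require Import boolp classical_sets.

Set Implicit Arguments.
Unset Strict Implicit.
Unset Printing Implicit Defensive.

Import GroupScope GRing.Theory.
Local Open Scope ring_scope.

Section Rings.
Variable R : comNzRingType.
Implicit Types I J m : set R.

Definition is_ideal I : Prop :=
  [/\ I 0, forall x y, I x -> I y -> I (x + y) & forall a x, I x -> I (a * x)].

Definition maximal_ideal m : Prop :=
  [/\ is_ideal m, ~ m 1
    & forall I, is_ideal I -> (m `<=` I)%classic -> ~ I 1 -> I = m].

Definition local_ring m : Prop :=
  maximal_ideal m /\ forall m', maximal_ideal m' -> m' = m.

Definition noetherian : Prop :=
  forall I, is_ideal I ->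
  exists s : seq R, forall x,
    I x <-> exists c : 'I_(size s) -> R, x = \sum_(i < size s) c i * s`_i.

Definition ideal_mul I J : set R := fun x =>
  exists2 s : seq (R * R), (forall yz, yz \in s -> I yz.1 /\ J yz.2)
                         & x = \sum_(yz <- s) yz.1 * yz.2.

Fixpoint ideal_exp I n : set R :=
  if n is n'.+1 then ideal_mul I (ideal_exp I n') else setT.

Definition adic_complete I : Prop :=
  (forall x, (forall n, ideal_exp I n x) -> x = 0) /\
  forall u : nat -> R,
    (forall n, exists N, forall i j,
       (N <= i)%N -> (N <= j)%N -> ideal_exp I n (u i - u j)) ->
    exists x, forall n, exists N, forall i, (N <= i)%N -> ideal_exp I n (u i - x).

(* [k] is the quotient [R / m], with projection [pi]. *)
Definition residue_map m (k : fieldType) (pi : {rmorphism R -> k}) : Prop :=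
  (forall y, exists x, pi x = y) /\ (forall x, m x <-> pi x = 0).

End Rings.

(* The group algebra of the whole finite group [gT]; the product is the
   convolution of coefficient functions. *)
Definition groupalg (R : comNzRingType) (gT : finGroupType) :=
  {ffun gT -> R^o}.

Section GroupAlgebra.
Variables (R : comNzRingType) (gT : finGroupType).
Local Notation RG := (groupalg R gT).
Implicit Types (x y z : RG) (g h : gT).

HB.instance Definition _ := GRing.Lmodule.copy RG {ffun gT -> R^o}.

Definition galg g : RG := [ffun h => (h == g)%:R].
Definition groupalg_mul x y : RG := [ffun g => \sum_h x h * y (h^-1 * g)%g].

Fact groupalg_mulA : associative groupalg_mul.
Proof.
move=> x y z; apply/ffunP => g; rewrite !ffunE.
under eq_bigr => h _ do rewrite ffunE mulr_sumr.
under [RHS]eq_bigr => h _ do rewrite ffunE mulr_suml.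
rewrite [RHS]exchange_big; apply: eq_bigr => h _.
rewrite (reindex_inj (mulgI h^-1)%g); apply: eq_bigr => j _ /=.
by rewrite mulrA invMg invgK !mulgA mulgK.
Qed.

Fact groupalg_mul1 : left_id (galg 1%g) groupalg_mul.
Proof.
move=> x; apply/ffunP => g; rewrite ffunE (bigD1 1%g) //= ffunE eqxx mul1r.
rewrite invg1 mul1g big1 ?addr0 // => h /negPf h1.
by rewrite ffunE h1 mul0r.
Qed.

Fact groupalg_mulr1 : right_id (galg 1%g) groupalg_mul.
Proof.
move=> x; apply/ffunP => g; rewrite ffunE (bigD1 g) //= ffunE mulVg eqxx mulr1.
rewrite big1 ?addr0 // => h hg.
by rewrite ffunE -eq_mulVg1 (negPf hg) mulr0.
Qed.

Fact groupalg_mulDl : left_distributive groupalg_mul +%R.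
Proof.
move=> x y z; apply/ffunP => g; rewrite !ffunE -big_split.
by apply: eq_bigr => h _; rewrite ffunE mulrDl.
Qed.

Fact groupalg_mulDr : right_distributive groupalg_mul +%R.
Proof.
move=> x y z; apply/ffunP => g; rewrite !ffunE -big_split.
by apply: eq_bigr => h _; rewrite ffunE mulrDr.
Qed.

Fact groupalg_1neq0 : galg 1%g != 0.
Proof. by apply/eqP => /ffunP/(_ 1%g)/eqP; rewrite !ffunE eqxx oner_eq0. Qed.

HB.instance Definition _ := GRing.Zmodule_isNzRing.Build RG
  groupalg_mulA groupalg_mul1 groupalg_mulr1
  groupalg_mulDl groupalg_mulDr groupalg_1neq0.

Fact groupalg_scaleAl (a : R) x y : a *: (x * y) = (a *: x) * y.
Proof.
apply/ffunP => g; rewrite !ffunE scaler_sumr.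
by apply: eq_bigr => h _; rewrite !ffunE scalerAl.
Qed.

HB.instance Definition _ := GRing.Lmodule_isLalgebra.Build R RG groupalg_scaleAl.

Fact groupalg_scaleAr (a : R) x y : a *: (x * y) = x * (a *: y).
Proof.
apply/ffunP => g; rewrite !ffunE scaler_sumr.
by apply: eq_bigr => h _; rewrite !ffunE /GRing.scale /= mulrCA.
Qed.

HB.instance Definition _ := GRing.Lalgebra_isAlgebra.Build R RG groupalg_scaleAr.

(* Left conjugation [g x g^-1], unlike MathComp's right action [x ^ g]. *)
Definition gconj g x : RG := galg g * x * galg g^-1%g.

Definition fixed_points (P : {set gT}) : set RG :=
  fun x => forall u, u \in P -> gconj u x = x.

(* For a subgroup [H], the group algebra of [H] inside that of [gT]. *)
Definition groupalg_of (H : {set gT}) : set RG :=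
  fun x => forall g, g \notin H -> x g = 0.

(* [x] is fixed by [P] in all uses, so that the choice of coset
   representatives does not matter. *)
Definition relative_trace (P : {set gT}) x : RG :=
  \sum_(U in lcosets P [set: gT]) gconj (repr U) x.

(* [D] is minimal among the subgroups [P] such that [b] is a relative trace
   from the [P]-fixed points of the group algebra. *)
Definition defect_group (b : RG) (D : {group gT}) : Prop :=
  let proj (P : {group gT}) :=
    exists2 x, fixed_points P x & b = relative_trace P x in
  proj D /\ forall P : {group gT}, P \subset D -> proj P -> P = D.

Definition biact (uv : gT * gT) x : RG := galg uv.1 * x * galg uv.2^-1%g.

End GroupAlgebra.

Arguments galg {R gT} g.

Section Subalgebras.
Variables (R : comNzRingType) (V : algType R).
Implicit Types (S B : set V) (e x y : V).

Definition center_of S : set V := fun x => S x /\ forall y, S y -> x * y = y * x.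

Definition primitive_idempotent S e : Prop :=
  [/\ S e, e * e = e, e != 0
    & forall f g, S f -> S g -> f * f = f -> g * g = g ->
        f * g = 0 -> g * f = 0 -> e = f + g -> f = 0 \/ g = 0].

Definition block_idempotent S e : Prop := primitive_idempotent (center_of S) e.

Definition corner e : set V := fun x => exists y, x = e * y * e.

(* [e] is the identity of [S]; it need not be that of [V]. *)
Definition unit_in S e x : Prop :=
  S x /\ exists y, [/\ S y, x * y = e & y * x = e].

Definition subalgebra S e B : Prop :=
  [/\ (B `<=` S)%classic, B e, forall x y, B x -> B y -> B (x + y),
      forall (a : R) x, B x -> B (a *: x)
    & forall x y, B x -> B y -> B (x * y)].

Definition module_basis S (X : seq V) : Prop :=
  [/\ forall x, x \in X -> S x,
      forall c : 'I_(size X) -> R,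
        \sum_(i < size X) c i *: X`_i = 0 -> forall i, c i = 0
    & forall x, S x ->
        exists c : 'I_(size X) -> R, x = \sum_(i < size X) c i *: X`_i].

End Subalgebras.

Definition stable_unital_basis (R : comNzRingType) (gT : finGroupType)
    (S : set (groupalg R gT)) (e : groupalg R gT) (H : {set gT * gT})
    (X : seq (groupalg R gT)) : Prop :=
  [/\ module_basis S X, forall x, x \in X -> unit_in S e x
    & forall uv x, uv \in H -> x \in X -> biact uv x \in X].

Section Sources.
Variables (O : comNzRingType) (k : fieldType) (pi : {rmorphism O -> k}).
Variables (p : nat) (gT : finGroupType).
Local Notation OG := (groupalg O gT).
Local Notation kG := (groupalg k gT).
Implicit Types (b l : OG) (P R D : {group gT}).

(* The Brauer homomorphism is the restriction of this map to the fixed points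
   of [P]: truncate to ['C(P)] and reduce the coefficients. *)
Definition brauer_map (P : {set gT}) (x : OG) : kG :=
  [ffun g => if g \in 'C(P) then pi (x g) else 0].

(* [l] is a primitive idempotent of [(OGb)^D] with nonzero Brauer image. *)
Definition source_idempotent b D l : Prop :=
  primitive_idempotent
    (fun x => fixed_points D x /\ exists y, x = y * b) l
  /\ brauer_map D l != 0.

(* [e] is the block [e_R] of [kC_G(R)] determined by [l]. *)
Definition source_block l R (e : kG) : Prop :=
  block_idempotent (groupalg_of 'C(R)) e /\ brauer_map R l * e != 0.

(* The restriction of [f] to [R1] is a morphism [R1 -> R2] of the fusion
   system.  MathComp's [x ^ g] is [g^-1 * x * g], whence the inverses. *)
Definition fusion_morphism D l R1 R2 (f : gT -> gT) : Prop :=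
  [/\ R1 \subset D, R2 \subset D
    & exists g, [/\ R1 :^ g^-1 \subset R2,
                    forall u, u \in R1 -> f u = (u ^ g^-1)%g
                  & exists2 e, source_block l R1 e
                             & source_block l (R1 :^ g^-1)%G (gconj g e)]].

(* This set is a group when [source_block] determines a unique block at each
   subgroup of [D]; it is left as a set, which is all [p_residual] needs. *)
Definition fusion_aut D l R : {set {perm gT}} :=
  [set f in Aut R | `[< fusion_morphism D l R R f >]].

(* The smallest normal subgroup with quotient a [p]-group, as the intersection
   of all of them. *)
Definition p_residual (hT : finGroupType) (X : {set hT}) : {set hT} :=
  \bigcap_(N : {group hT} | (N <| X) && p.-group (X / N)%g) N.

Definition hyperfocal_subgroup D l : {set gT} :=
  <<\bigcup_(R : {group gT} | R \subset D)
      [set (u * (f : {perm gT}) u^-1)%g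
        | u in R, f in p_residual (fusion_aut D l R)]>>.

End Sources.

Section Hyperfocal.
Variables (O : comNzRingType) (gT : finGroupType).
Local Notation OG := (groupalg O gT).
Implicit Types (l : OG) (D Dt : {group gT}) (At : set OG).

(* The last two clauses say that [corner l] is the direct sum of the [At * u],
   with [u] running over representatives of [D / Dt]. *)
Definition hyperfocal_subalgebra l D Dt At : Prop :=
  [/\ subalgebra (corner l) l At,
      forall u a, u \in D -> At a -> At (gconj u a),
      forall x, At x /\ (exists2 u, u \in D & x = galg u * l)
        <-> (exists2 u, u \in Dt & x = galg u * l),
      forall a, corner l a ->
        exists2 f : coset_of Dt -> OG, (forall ub, At (f ub))
          & a = \sum_(ub in (D / Dt)%g) f ub * galg (repr ub)
    & forall f : coset_of Dt -> OG, (forall ub, At (f ub)) ->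
        \sum_(ub in (D / Dt)%g) f ub * galg (repr ub) = 0 ->
        forall ub, ub \in (D / Dt)%g -> f ub = 0].

(* [D x^{D/Dt} D] *)
Definition fiber_square (D Dt : {set gT}) : {set gT * gT} :=
  [set uv | [&& uv.1 \in D, uv.2 \in D & (uv.1 *: Dt == uv.2 *: Dt)%g]].

End Hyperfocal.

(* Main.v *)
Require Import Defs.
From HB Require Import structures.
From mathcomp Require Import all_boot all_order all_algebra.
From mathcomp Require Import all_fingroup all_solvable.
From mathcomp Require Import boolp classical_sets.

Set Implicit Arguments.
Unset Strict Implicit.
Unset Printing Implicit Defensive.

Import GroupScope GRing.Theory.
Local Open Scope ring_scope.

(** The algebra [corner l] is a crossed product: it is the direct sum of the
    translates [At * u], with [u] running over representatives of [D / Dt].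
    Given a basis [Xt] of [At] stable under the fiber square, the products [x * u]
    with [x] in [Xt] therefore form a basis of [corner l] (module_basis_product).
    Each is invertible, because [l] is fixed by [D], so that [u * l] is a unit of
    [corner l] (unit_in_mul_galg).

    For the stability under [D * D], note first that this basis consists of all
    products [x * g] with [x] in [Xt] and [g] in [D], and not only of those where
    [g] is a chosen representative: write [g = t * u] with [t] in [Dt]; then
    [x * t] lies in [Xt], since [(1, t^-1)] is in the fiber square
    (product_family_mem).  Now
<<
      u (x g) v^-1 = (u x u^-1) (u g v^-1),
>>
    and [u x u^-1] lies in [Xt], since the diagonal is in the fiber square, so
    the result is again such a product. *)

Section GroupElements.
Variables (O : comNzRingType) (gT : finGroupType).
Local Notation OG := (groupalg O gT).

Lemma galg1 : galg 1%g = 1 :> OG.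
Proof. by []. Qed.

Lemma galgM (g h : gT) : galg (g * h)%g = galg g * galg h :> OG.
Proof.
apply/ffunP => j; rewrite !ffunE (bigD1 g) //= !ffunE eqxx mul1r big1 ?addr0.
  by rewrite -[in RHS](inj_eq (mulgI g)) mulKVg.
by move=> i /negPf gi; rewrite ffunE gi mul0r.
Qed.

Lemma galgVK (g : gT) : galg g^-1%g * galg g = 1 :> OG.
Proof. by rewrite -galgM mulVg. Qed.

Lemma galgKV (g : gT) : galg g * galg g^-1%g = 1 :> OG.
Proof. by rewrite -galgM mulgV. Qed.

Lemma fixed_points_comm (D : {set gT}) (l : OG) (u : gT) :
  fixed_points D l -> u \in D -> galg u * l = l * galg u.
Proof. by move=> fixl /fixl {2}<-; rewrite /gconj -mulrA galgVK mulr1. Qed.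

End GroupElements.

(** [module_basis] speaks of sequences; families indexed by a finite type are
    what a basis made of products, indexed by pairs, calls for. *)
Lemma module_basis_codom (R : comNzRingType) (V : algType R) (S : set V)
    (I : finType) (v : I -> V) :
    (forall i, S (v i)) ->
    (forall c : I -> R, \sum_i c i *: v i = 0 -> forall i, c i = 0) ->
    (forall x, S x -> exists c : I -> R, x = \sum_i c i *: v i) ->
  module_basis S (codom v).
Proof.
move=> Sv freev spanv; have szv : size (codom v) = #|I| by rewrite size_codom.
pose rank (i : I) : 'I_(size (codom v)) := cast_ord (esym szv) (enum_rank i).
pose unrank (j : 'I_(size (codom v))) : I := enum_val (cast_ord szv j).
have rankK : cancel rank unrank.
  by move=> i; rewrite /unrank /rank cast_ordKV enum_rankK.
have unrankK : cancel unrank rank.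
  by move=> j; rewrite /unrank /rank enum_valK cast_ordK.
have nth_rank i : (codom v)`_(rank i) = v i.
  by rewrite /rank /= nth_image enum_rankK.
have sum_rank (c : 'I_(size (codom v)) -> R) :
    \sum_j c j *: (codom v)`_j = \sum_i c (rank i) *: v i.
  rewrite (reindex rank) /=; last by exists unrank => j _.
  by apply: eq_bigr => i _; rewrite nth_rank.
split=> [_ /codomP[i ->] // | c | x /spanv[c ->]].
  by rewrite sum_rank => /freev c0 j; rewrite -(unrankK j) c0.
exists (c \o unrank); rewrite sum_rank.
by apply: eq_bigr => i _; rewrite /= rankK.
Qed.

(** The factor in [Dt] has to come out on the left of the representative, next to
    the coefficient in [At] that will absorb it. *)
Lemma mul_repr_coset (gT : finGroupType) (D Dt : {group gT}) (g : gT) :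
  (Dt <| D)%g -> g \in D ->
  exists2 t, t \in Dt & g = (t * repr (coset Dt g))%g.
Proof.
move=> /normal_norm nDt Dg; have Ng := fintype.subsetP nDt g Dg.
rewrite val_coset //; have /rcosetP[t Dt_t ->] := mem_repr_rcoset Dt g.
by exists t^-1%g; rewrite ?groupV // mulKg.
Qed.

Lemma repr_quotient_mem (gT : finGroupType) (D Dt : {group gT})
    (ub : coset_of Dt) :
  (Dt <| D)%g -> ub \in (D / Dt)%g -> repr ub \in D.
Proof.
move=> nsDt /morphimP[g _ Dg ->].
have [t Dt_t g_eq] := mul_repr_coset nsDt Dg.
by rewrite -(groupMl _ (fintype.subsetP (normal_sub nsDt) t Dt_t)) -g_eq.
Qed.

Section CrossedProduct.
Variables (O : comNzRingType) (gT : finGroupType).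
Variables (l : groupalg O gT) (D Dt : {group gT}) (At : set (groupalg O gT)).
Hypotheses (fixl : fixed_points D l) (nsDt : (Dt <| D)%g).
Hypothesis hAt : hyperfocal_subalgebra l D Dt At.
Variable Xt : seq (groupalg O gT).
Local Notation Q := (D / Dt)%g.
Local Notation n := (size Xt).

Definition product_family (ji : 'I_#|Q| * 'I_n) : groupalg O gT :=
  Xt`_ji.2 * galg (repr (enum_val ji.1)).

Lemma sum_product_family (c : 'I_#|Q| * 'I_n -> O) :
  \sum_ji c ji *: product_family ji =
  \sum_(j < #|Q|) (\sum_(i < n) c (j, i) *: Xt`_i) * galg (repr (enum_val j)).
Proof.
under [RHS]eq_bigr => j _ do rewrite mulr_suml.
by rewrite pair_bigA; apply: eq_bigr => [[j i] _] /=; rewrite scalerAl.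
Qed.

Lemma corner_mulr_galg (x : groupalg O gT) (g : gT) :
  g \in D -> corner l x -> corner l (x * galg g).
Proof.
move=> Dg [y ->]; exists (y * galg g).
by rewrite -!mulrA (fixed_points_comm fixl).
Qed.

Lemma corner_mull_galg (x : groupalg O gT) (g : gT) :
  g \in D -> corner l x -> corner l (galg g * x).
Proof.
move=> Dg [y ->]; exists (galg g * y).
by rewrite !mulrA (fixed_points_comm fixl).
Qed.

Lemma unit_in_mul_galg (x : groupalg O gT) (g : gT) :
  g \in D -> unit_in At l x -> unit_in (corner l) l (x * galg g).
Proof.
have [[sAt _ _ _ _] _ _ _ _] := hAt.
move=> Dg [Ax [y [Ay xy yx]]]; split; first exact/corner_mulr_galg/sAt.
exists (galg g^-1%g * y); split.
- by apply: corner_mull_galg; [rewrite groupV | apply: sAt].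
- by rewrite mulrA -(mulrA x) galgKV mulr1.
- rewrite mulrA -(mulrA _ y) yx (fixed_points_comm fixl) ?groupV //.
  by rewrite -mulrA galgVK mulr1.
Qed.

(** The two levels of freeness and generation compose: the coefficients in [At]
    on the representatives of [D / Dt] are unique, and so are the scalar
    coefficients of each of them on [Xt]. *)
Lemma module_basis_product : module_basis At Xt ->
  module_basis (corner l) (codom product_family).
Proof.
have [[sAt Al AD AZ _] _ _ spanA freeA] := hAt.
have At0 : At 0 by rewrite -(scale0r l); apply: AZ.
move=> [AXt freeXt spanXt].
have AtP (j : 'I_n) : At Xt`_j by apply/AXt/mem_nth.
apply: module_basis_codom => [[j i] | c | a /spanA[f Af ->]].
- apply/corner_mulr_galg/sAt/AtP.
  exact: repr_quotient_mem nsDt (enum_valP j).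
- rewrite sum_product_family => c0 [j i].
  (* A function on all of [coset_of Dt], as freeness over [At] requires: its
     value is an empty sum outside the quotient of [D]. *)
  pose f ub : groupalg O gT := \sum_(j < #|Q| | enum_val j == ub)
                                 \sum_(i < n) c (j, i) *: Xt`_i.
  have fE j' : f (enum_val j') = \sum_(i < n) c (j', i) *: Xt`_i.
    by rewrite /f (big_pred1 j') // => j1; rewrite (inj_eq enum_val_inj).
  have Af ub : At (f ub).
    rewrite /f; apply: (big_ind At) => // j' _.
    by apply: (big_ind At) => // i' _; apply: AZ.
  apply: (freeXt (fun i => c (j, i))); rewrite -fE.
  apply: (freeA f Af); last exact: enum_valP.
  by rewrite big_enum_val -[RHS]c0; apply: eq_bigr => j' _; rewrite fE.
have /choice[c fE] ub := spanXt _ (Af ub).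
exists (fun ji => c (enum_val ji.1) ji.2).
by rewrite sum_product_family big_enum_val; apply: eq_bigr => j _; rewrite fE.
Qed.

(** Replacing [g] by the representative of its coset costs a factor [t] in [Dt] to
    the right of [x], and the right translations by [Dt] permute [Xt]. *)
Lemma product_family_mem (x : groupalg O gT) (g : gT) :
    (forall uv y, uv \in fiber_square D Dt -> y \in Xt -> biact uv y \in Xt) ->
    x \in Xt -> g \in D ->
  x * galg g \in codom product_family.
Proof.
move=> stXt Xx Dg; have [t Dt_t {1}->] := mul_repr_coset nsDt Dg.
have Xxt : x * galg t \in Xt.
  have -> : x * galg t = biact (1%g, t^-1%g) x.
    by rewrite /biact /= invgK galg1 mul1r.
  apply: stXt => //; rewrite inE /= !lcoset_id ?groupV //.
  by rewrite eqxx group1 (fintype.subsetP (normal_sub nsDt)).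
have Qg : coset Dt g \in Q by apply: mem_quotient.
have lt_i : (index (x * galg t)%R Xt < n)%N by rewrite index_mem.
apply/codomP; exists (enum_rank_in Qg (coset Dt g), Ordinal lt_i).
by rewrite /product_family /= enum_rankK_in // nth_index // galgM mulrA.
Qed.

Lemma stable_unital_basis_product :
  stable_unital_basis At l (fiber_square D Dt) Xt ->
  stable_unital_basis (corner l) l (finset.setX D D) (codom product_family).
Proof.
move=> [bXt uXt stXt]; split; first exact: module_basis_product.
  move=> _ /codomP[[j i] ->]; apply: unit_in_mul_galg.
    exact: repr_quotient_mem nsDt (enum_valP j).
  exact/uXt/mem_nth.
move=> [u v] _ /finset.setXP[/= Du Dv] /codomP[[j i] ->].
have Dr := repr_quotient_mem nsDt (enum_valP j).
set r := repr (enum_val j) in Dr *.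
have -> : biact (u, v) (product_family (j, i)) =
          biact (u, u) Xt`_i * galg (u * r * v^-1)%g.
  rewrite /biact /product_family /= -/r !galgM !mulrA.
  by rewrite -(mulrA _ (galg u^-1%g)) galgVK mulr1.
apply: product_family_mem; rewrite ?groupM ?groupV //.
by apply: stXt; rewrite ?mem_nth // inE /= Du eqxx.
Qed.

End CrossedProduct.

Theorem theorem1p3
    (O : comNzRingType) (m : set O) (k : closedFieldType)
    (pi : {rmorphism O -> k}) (p : nat) (gT : finGroupType)
    (hlocal : local_ring m) (hnoeth : noetherian O) (hcompl : adic_complete m)
    (hres : residue_map m pi) (hchar : p \in [pchar k]) (hpG : (p %| #|gT|)%N)
    (b : groupalg O gT) (hb : block_idempotent setT b)
    (D : {group gT}) (hpD : p.-group D) (hD : defect_group b D)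
    (l : groupalg O gT) (hl : source_idempotent pi b D l)
    (Dt : {group gT}) (hDt : (Dt <| D)%g)
    (hhyp : hyperfocal_subgroup pi p D l \subset Dt)
    (At : set (groupalg O gT)) (hAt : hyperfocal_subalgebra l D Dt At) :
  (exists Xt, stable_unital_basis At l (fiber_square D Dt) Xt) ->
  exists X, stable_unital_basis (corner l) l (finset.setX D D) X.
Proof.
have [[[fixl _] _ _ _] _] := hl.
move=> [Xt bXt]; exists (codom (@product_family O gT D Dt Xt)).
exact: (stable_unital_basis_product fixl hDt hAt bXt).
Qed.
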